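(* Let $S_N=\sum_{n=1}^N X_n$ be a random walk on $\mathbb{Z}$ (so $d=1$) with i.i.d. steps satisfying the non-degeneracy and aperiodicity assumptions of the context. Suppose that $v=\mathbb{E}(X_1)>0$ and that there are constants $C>0$ and $\beta>1$ such that $\mathbb{P}(|X_1|>t)\le C/t^\beta$ for all $t\ge1$. If $F\in\mathbf{G}_+$ and $T_N=\sum_{n=1}^NF(S_n)$, then $\frac{T_N}{N}\to\bar F_+$ almost surely as $N\to\infty$.
   Context: $X_1,X_2,\dots$ are i.i.d. $\mathbb{Z}$-valued random variables, $S_0=0$, $S_N=\sum_{n=1}^N X_n$. Standing assumptions: (non-degeneracy) the smallest group supporting the range of $X_1$ is $\mathbb{Z}$; (aperiodicity) $\gcd\{n>0:\mathbb{P}(S_n=0)>0\}=1$. $\mathbf{G}_+$ is the space of bounded functions $F:\mathbb{Z}\to\mathbb{R}$ such that the limit $\bar F_+=\lim_{v\to\infty}\bar F_{[0,v]}$ exists, where $\bar F_{[0,v]}$ is the average of $F$ over the integers in $[0,v]$. *)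

(* Defs.v *)
From HB Require Import structures.
From mathcomp Require Import all_boot all_order all_algebra.
From mathcomp Require Import finmap.
From mathcomp Require Import all_classical all_reals all_analysis.

Set Implicit Arguments.
Unset Strict Implicit.
Unset Printing Implicit Defensive.

Import Order.TTheory GRing.Theory Num.Theory.
Import numFieldNormedType.Exports.

Local Open Scope classical_set_scope.
Local Open Scope ring_scope.

(* The discrete sigma-algebra on [int], as the library does for [nat]. *)
HB.instance Definition _ := isPointed.Build int 0.
HB.instance Definition _ := @isMeasurable.Build default_measure_display
  int discrete_measurable discrete_measurable0
  discrete_measurableC discrete_measurableU.

Definition mutually_independent d d' (T : measurableType d)
    (T' : measurableType d') (R : realType) (P : probability T R)
    (X : nat -> {RV P >-> T'}) : Prop :=
  forall (J : {fset nat}) (A : nat -> set T'),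
    (forall i, measurable (A i)) ->
    P (\bigcap_(i in [set` J]) (X i @^-1` A i)) =
      (\prod_(i <- J) P (X i @^-1` A i))%E.

Definition identically_distributed d d' (T : measurableType d)
    (T' : measurableType d') (R : realType) (P : probability T R)
    (X : nat -> {RV P >-> T'}) : Prop :=
  forall m n (A : set T'), measurable A ->
    distribution P (X m) A = distribution P (X n) A.

Definition iid d d' (T : measurableType d)
    (T' : measurableType d') (R : realType) (P : probability T R)
    (X : nat -> {RV P >-> T'}) : Prop :=
  mutually_independent X /\ identically_distributed X.

(* Sequences are indexed from 0: [X n] is the step X_{n+1}, so that
   [walk X N] = X_1 + ... + X_N and [walk X 0] = 0. *)
Definition walk (T : Type) (X : nat -> T -> int) (N : nat) (w : T) : int :=
  \sum_(i < N) X i w.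

Definition occupation_sum (T : Type) (R : realType) (F : int -> R)
    (X : nat -> T -> int) (N : nat) (w : T) : R :=
  \sum_(1 <= n < N.+1) F (walk X n w).

(* The values taken with positive probability: the range of a discrete random
   variable up to null events. *)
Definition ess_range d (T : measurableType d) (R : realType)
    (P : probability T R) (Y : T -> int) : set int :=
  [set k | (0 < P (Y @^-1` [set k]))%E].

Definition subgroup (H : set int) : Prop := zmod_closed (mem H).

Definition nondegenerate_walk d (T : measurableType d) (R : realType)
    (P : probability T R) (X : nat -> {RV P >-> int}) : Prop :=
  smallest subgroup (ess_range P (X 0)) = [set: int].

(* The gcd of a possibly infinite set of naturals; that of the empty set
   is 0. *)
Definition is_gcd (A : set nat) (g : nat) : Prop :=
  (forall n, A n -> g %| n)%N /\
  (forall e, (forall n, A n -> e %| n) -> e %| g)%N.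

Definition aperiodic_walk d (T : measurableType d) (R : realType)
    (P : probability T R) (X : nat -> {RV P >-> int}) : Prop :=
  is_gcd [set n | (0 < n)%N /\ (0 < P (walk X n @^-1` [set 0%R]))%E] 1.

Definition average_right (R : realType) (F : int -> R) (v : nat) : R :=
  (\sum_(0 <= k < v.+1) F k%:Z) / v.+1%:R.

Definition G_plus (R : realType) : set (int -> R) :=
  [set F | bounded_fun F /\ cvgn (average_right F)].

Definition mean_right (R : realType) (F : int -> R) : R :=
  limn (average_right F).

(* Main.v *)
(* Write S_n for the walk and L f for the mean of f (X_1). Truncation, second
   moments and Borel-Cantelli along the times j^q give a strong law for
   controlled increments: if |phi x k| <= c (1 + |k|), then
   1/N sum_{n < N} (phi (S_n, X_{n+1}) - L (phi (S_n, .))) -> 0 almost surely.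

   For G bounded and (P G) x = L (G (x + .)), taking phi (x, k) = G (x + k)
   shows that G and P G, hence G and P^m G, have the same averages along the
   walk. If p = P (X_1 = a) > 0, exchangeability of the first m steps gives
   p |P^(m-1) G (x + a) - P^m G x| <= sup |G| / sqrt m, so G (. + a) and G have
   the same averages along the walk; by non-degeneracy this extends to every
   translation.

   Finally let Phi (x + 1) - Phi x = F x. By the strong law, Phi (S_N) / N is
   asymptotically the average of L (Phi (x + .) - Phi x) over x = S_0, ...,
   S_(N-1), and Phi (x + k) - Phi x is a sum of k translates of F, so that, by
   dominated convergence in k, this average is asymptotically E (X_1) times
   that of F. On the other hand Phi (S_N) / N -> E (X_1) mean_right F since
   S_N / N -> E (X_1) > 0. *)
Require Import Defs.
From HB Require Import structures.
From mathcomp Require Import all_boot all_order all_algebra.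
From mathcomp Require Import finmap.
From mathcomp Require Import all_classical all_reals all_analysis.
From mathcomp Require Import measurable_realfun.
From mathcomp Require Import ring lra zify.

Set Implicit Arguments.
Unset Strict Implicit.
Unset Printing Implicit Defensive.

Import Order.TTheory GRing.Theory Num.Theory.
Import numFieldNormedType.Exports.

Local Open Scope classical_set_scope.
Local Open Scope ring_scope.

(** * Finite histories of the walk *)

Fixpoint hist (T U : Type) (X : nat -> T -> U) (n : nat) (w : T) : seq U :=
  if n is m.+1 then X m w :: hist X m w else [::].

Definition position (s : seq int) : int := \sum_(k <- s) k.

Lemma walkE (T : Type) (X : nat -> T -> int) n w :
  walk X n w = position (hist X n w).
Proof.
elim: n => [|n IHn]; rewrite /walk /position ?big_ord0 ?big_nil//=.
by rewrite big_ord_recr /= big_cons addrC; congr (_ + _).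
Qed.

Lemma walkS (T : Type) (X : nat -> T -> int) n w :
  walk X n.+1 w = walk X n w + X n w.
Proof. by rewrite /walk big_ord_recr. Qed.

(** A history lists the latest step first, whence the reversed index [n.-1 - i]. This turns an event
    on the history into conditions on single steps, the form in which independence is given. *)
Lemma hist_eqP (T : Type) (U : eqType) (X : nat -> T -> U) u0 n s w :
  size s = n -> (hist X n w = s) <->
  (forall i, (i < n)%N -> X i w = nth u0 s (n.-1 - i)).
Proof.
elim: n s => [|n IHn] [|a s] //=.
move=> [ss]; split=> [[Xa hs] i|H].
- rewrite ltnS leq_eqVlt => /orP[/eqP->|iltn]; first by rewrite subnn.
  have -> : (n - i = (n.-1 - i).+1)%N by lia.
  by rewrite /=; apply: (IHn s ss).1.
- congr (_ :: _); first by rewrite H // subnn.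
  apply/(IHn s ss) => i iltn; rewrite H ?ltnS 1?ltnW//.
  by have -> : (n - i = (n.-1 - i).+1)%N by lia.
Qed.

(** * Measurability and integration along maps with countably many values *)

Section countable_values.
Local Open Scope ereal_scope.
Context d (T : measurableType d) (R : realType) (P : {measure set T -> \bar R}).
Context (U : countType) (Y : T -> U).
Hypothesis mY : forall u, measurable (Y @^-1` [set u]).

Lemma measurable_preimage_countable (Q : set U) : measurable (Y @^-1` Q).
Proof.
rewrite (_ : _ @^-1` _ =
    \bigcup_(u in setT) ((Y @^-1` [set u]) `&` [set w | Q u])).
  apply: countable_bigcupT_measurable => // u; apply: measurableI => //.
  have [Qu|nQu] := pselect (Q u).
    by rewrite (_ : [set _ | _] = setT)//; apply/seteqP; split.
  by rewrite (_ : [set _ | _] = set0)//; apply/seteqP; split.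
by apply/seteqP; split=> w /=; [move=> QY; exists (Y w)|move=> [u _ [-> Qu]]].
Qed.

Lemma measurable_fun_countable d' (V : measurableType d') (D : set T)
    (g : U -> V) :
  measurable D -> measurable_fun D (g \o Y).
Proof.
move=> mD _ B mB; apply: measurableI => //.
exact: (measurable_preimage_countable (g @^-1` B)).
Qed.

Lemma ge0_integral_countable (E : set T) (f : T -> \bar R) :
  measurable E -> measurable_fun E f -> (forall w, 0 <= f w) ->
  \int[P]_(w in E) f w =
  \sum_(j <oo) \int[P]_(w in E `&` [set w | choice.pickle (Y w) = j]) f w.
Proof.
move=> mE mf f0.
have mF j : measurable (E `&` [set w | choice.pickle (Y w) = j]).
  apply: measurableI => //.
  exact: (measurable_preimage_countable [set u | choice.pickle u = j]).
have EE : \bigcup_j (E `&` [set w | choice.pickle (Y w) = j]) = E.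
  apply/seteqP; split=> w /=; first by move=> [j _ []].
  by move=> Ew; exists (choice.pickle (Y w)).
rewrite -{1}EE ge0_integral_bigcup//; first by rewrite EE.
apply/trivIsetP => i j _ _ ij; apply/seteqP; split=> // w /= [[_ e1] [_ e2]].
by move: ij; rewrite -e1 -e2 eqxx.
Qed.

End countable_values.

(** * Factorization of integrals under independence *)

Section independence.
Local Open Scope ereal_scope.
Context d (T : measurableType d) (R : realType) (P : probability T R).

(** On each fibre of [Y] the integrand is constant, and the hypothesis factors the measure of the
    fibre inside [E]. When [P E] is positive, [Y0] carries the conditional law of [Y] given [E]. *)
Lemma ge0_integral_indep (U : countType) (Y Y0 : T -> U) (E : set T)
    (g : U -> \bar R) :
  measurable E ->
  (forall u, measurable (Y @^-1` [set u])) ->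
  (forall u, measurable (Y0 @^-1` [set u])) ->
  (forall u, P (E `&` (Y @^-1` [set u])) = P E * P (Y0 @^-1` [set u])) ->
  (forall u, 0 <= g u) ->
  \int[P]_(w in E) g (Y w) = P E * \int[P]_w g (Y0 w).
Proof.
move=> mE mY mY0 ind g0.
rewrite (ge0_integral_countable P mY)//; last exact: measurable_fun_countable.
rewrite [X in _ * X](ge0_integral_countable P mY0)//; last first.
  exact: measurable_fun_countable.
have PE : P E = (fine (P E))%:E by rewrite fineK// fin_num_measure.
rewrite PE -nneseriesZl; last by move=> j _; exact: integral_ge0.
apply: eq_eseriesr => j _; rewrite -PE.
have [[u uj]|nu] := pselect (exists u : U, choice.pickle u = j).
- have HS (Z : T -> U) : [set w | choice.pickle (Z w) = j] = Z @^-1` [set u].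
    apply/seteqP; split=> w /=; rewrite -uj; last by move=> ->.
    by move/(pcan_inj choice.pickleK).
  rewrite !HS setTI.
  rewrite (eq_integral (cst (g u))); last first.
    by move=> w; rewrite inE => -[_ /= ->].
  rewrite [in RHS](eq_integral (cst (g u))); last first.
    by move=> w; rewrite inE => /= ->.
  rewrite !integral_cst//; last exact: measurableI.
  by rewrite muleCA -ind.
- have HS (Z : T -> U) : [set w | choice.pickle (Z w) = j] = set0.
    by apply/seteqP; split=> // w /= Zj; apply: nu; exists (Z w).
  by rewrite !HS !setI0 !integral_set0 mule0.
Qed.

End independence.

(** * Independence of the next step from the history *)

Section history.
Local Open Scope ereal_scope.
Context d (T : measurableType d) (R : realType) (P : probability T R).
Context (X : nat -> {RV P >-> int}).
Hypothesis Xiid : iid X.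

Lemma measurable_step n (Q : set int) : measurable (X n @^-1` Q).
Proof. by rewrite -[X in measurable X]setTI; apply: measurable_funP. Qed.

Lemma measurable_hist n (s : seq int) : measurable (hist X n @^-1` [set s]).
Proof.
elim: n s => [|n IHn] [|a s] /=.
- by rewrite (_ : _ @^-1` _ = setT)//; apply/seteqP; split.
- by rewrite (_ : _ @^-1` _ = set0)//; apply/seteqP; split.
- by rewrite (_ : _ @^-1` _ = set0)//; apply/seteqP; split.
- rewrite (_ : _ @^-1` _ = (X n @^-1` [set a]) `&` (hist X n @^-1` [set s])).
    by apply: measurableI => //; exact: measurable_step.
  by apply/seteqP; split=> w /=; [move=> [-> ->]|move=> [-> ->]].
Qed.

Lemma measurable_fun_hist d' (V : measurableType d') (D : set T)
    (g : seq int -> V) n : measurable D ->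
  measurable_fun D (fun w => g (hist X n w)).
Proof. exact: (measurable_fun_countable (measurable_hist n)). Qed.

Lemma measurable_fun_step d' (V : measurableType d') (D : set T)
    (g : int -> V) n : measurable D ->
  measurable_fun D (fun w => g (X n w)).
Proof.
by move=> mD; apply: (@measurable_fun_countable _ _ _ (X n)) => // u;
  exact: measurable_step.
Qed.

Lemma hist_step_indep n (s : seq int) (k : int) :
  P ((hist X n @^-1` [set s]) `&` (X n @^-1` [set k])) =
  P (hist X n @^-1` [set s]) * P (X 0%N @^-1` [set k]).
Proof.
have [ind idd] := Xiid.
(* [hist X n w] always has length [n], so for any other length of [s] both sides vanish. *)
have [sn|sn] := eqVneq (size s) n; last first.
  have -> : hist X n @^-1` [set s] = set0.
    apply/seteqP; split=> // w /= ws; move/negP: sn; apply.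
    by rewrite -ws; apply/eqP; elim: (n) => //= m ->.
  by rewrite set0I measure0 mul0e.
have <- : P (X n @^-1` [set k]) = P (X 0%N @^-1` [set k]) by exact: idd.
(* Prescribed values of the steps: [s] read backwards below index [n], and [k] from index [n] on. *)
pose A i := if (i < n)%N then [set nth 0%R s (n.-1 - i)] else [set k].
have in_iota m i : (i \in [fset j in iota 0 m]%fset) = (i < m)%N.
  by rewrite inE mem_iota.
have memE m i : [set` [fset j in iota 0 m]%fset] i <-> (i < m)%N.
  by rewrite /mkset in_iota.
have HA : hist X n @^-1` [set s] =
    \bigcap_(i in [set` [fset j in iota 0 n]%fset]) (X i @^-1` A i).
  apply/seteqP; split=> w.
    move=> /(hist_eqP X 0%R w sn) H i /memE iltn.
    by rewrite /= /A iltn; exact: H.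
  move=> H; apply/(hist_eqP X 0%R w sn) => i iltn.
  have := H i ((memE n i).2 iltn).
  by rewrite /= /A iltn.
have HB : (hist X n @^-1` [set s]) `&` (X n @^-1` [set k]) =
    \bigcap_(i in [set` [fset j in iota 0 n.+1]%fset]) (X i @^-1` A i).
  rewrite HA; apply/seteqP; split=> w.
    move=> [H Hk] i /memE; rewrite ltnS leq_eqVlt.
    move=> /orP[/eqP->|iltn]; first by rewrite /= /A ltnn.
    by apply: H; apply/memE.
  move=> H; split.
    by move=> i /memE iltn; apply: H; apply/memE; rewrite ltnW.
  have := H n ((memE n.+1 n).2 (ltnSn n)).
  by rewrite /= /A ltnn.
rewrite HB HA !ind//.
have -> : [fset j in iota 0 n.+1]%fset = (n |` [fset j in iota 0 n])%fset.
  by apply/fsetP => i; rewrite in_fset1U !in_iota ltnS leq_eqVlt.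
rewrite big_fsetU1 /=; last by rewrite in_iota ltnn.
by rewrite muleC /A ltnn.
Qed.

(** A Fubini identity: once the history is frozen at one of its countably many values, the next step
    may be replaced by a separately integrated copy of [X 0]. *)
Lemma ge0_integral_hist_step n (h : seq int -> int -> \bar R) :
  (forall s k, 0 <= h s k) ->
  \int[P]_w h (hist X n w) (X n w) =
  \int[P]_w \int[P]_w' h (hist X n w) (X 0%N w').
Proof.
move=> h0.
rewrite (ge0_integral_countable P (measurable_hist n))//; last first.
  exact: (@measurable_fun_hist _ _ _
    (fun s => if s is k :: s' then h s' k else 0) n.+1).
rewrite [RHS](ge0_integral_countable P (measurable_hist n))//; last 2 first.
- exact: (@measurable_fun_hist _ _ _ (fun s => \int[P]_w' h s (X 0%N w'))).
- by move=> w; exact: integral_ge0.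
apply: eq_eseriesr => j _; rewrite setTI.
have [[u uj]|nu] := pselect (exists u : seq int, choice.pickle u = j); last first.
  rewrite (_ : [set _ | _] = set0) ?integral_set0//.
  by apply/seteqP; split=> // w /= Zj; apply: nu; exists (hist X n w).
rewrite (_ : [set _ | _] = hist X n @^-1` [set u]); last first.
  apply/seteqP; split=> w /=; rewrite -uj; last by move=> ->.
  by move/(pcan_inj choice.pickleK).
rewrite (eq_integral (fun w => h u (X n w))); last first.
  by move=> w; rewrite inE /= => ->.
rewrite [RHS](eq_integral (cst (\int[P]_w' h u (X 0%N w')))) ; last first.
  by move=> w; rewrite inE => hw; apply: eq_integral => w' _; rewrite hw.
rewrite integral_cst; last exact: measurable_hist.
rewrite muleC; apply: ge0_integral_indep => //.
- exact: measurable_hist.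
- by move=> k; exact: measurable_step.
- by move=> k; exact: measurable_step.
- exact: hist_step_indep.
Qed.

End history.

(** * Expectations over one step and the transition operator *)

Section step_expectation.
Context d (T : measurableType d) (R : realType) (P : probability T R).
Context (X : nat -> {RV P >-> int}).
Hypothesis X_int : P.-integrable setT (fun w => ((X 0%N w)%:~R : R)%:E).

Definition expect (f : int -> R) : R := \int[P]_w f (X 0%N w).

(** Domination by a multiple of the integrable [1 + |X_1|]. The explicit constant [c] allows bounds
    that are uniform in the position of the walk. *)
Definition affine_growth (c : R) (f : int -> R) :=
  forall k, `|f k| <= c * (1 + `|k%:~R|).

Lemma affine_growth_bounded B f : (forall k, `|f k| <= B) -> affine_growth B f.
Proof.
move=> fB k; have B0 : 0 <= B by exact: le_trans (fB k).
by apply: (le_trans (fB k)); rewrite ler_peMr// lerDl.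
Qed.

Lemma integrable_step c f : affine_growth c f ->
  P.-integrable setT (EFin \o (fun w => f (X 0%N w))).
Proof.
move=> fc.
have h1 : P.-integrable setT (fun w => (c * (1 + `|(X 0%N w)%:~R|))%:E).
  rewrite (_ : (fun _ => _) =
      (fun w => c%:E * (cst 1%:E \+ (fun w => `|((X 0%N w)%:~R : R)%:E|)) w)%E).
    apply: integrableZl => //; apply: integrableD => //.
      exact: finite_measure_integrable_cst.
    exact: integrable_abse.
  by apply/funext => w /=; rewrite EFinM EFinD.
apply: (le_integrable _ _ _ h1) => //.
  by apply: (@measurable_fun_step _ _ _ _ X _ _ _ (EFin \o f)).
move=> w _; rewrite !abse_EFin lee_fin.
exact: le_trans (fc _) (ler_norm _).
Qed.

Lemma expectD c1 c2 f g : affine_growth c1 f -> affine_growth c2 g ->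
  expect (fun k => f k + g k) = expect f + expect g.
Proof.
by move=> fc gc; rewrite /expect RintegralD//; exact: integrable_step.
Qed.

Lemma expectB c1 c2 f g : affine_growth c1 f -> affine_growth c2 g ->
  expect (fun k => f k - g k) = expect f - expect g.
Proof.
by move=> fc gc; rewrite /expect RintegralB//; exact: integrable_step.
Qed.

Lemma expectZ c r f : affine_growth c f ->
  expect (fun k => r * f k) = r * expect f.
Proof.
by move=> fc; rewrite /expect RintegralZl//; exact: integrable_step.
Qed.

Lemma le_expect c1 c2 f g : affine_growth c1 f -> affine_growth c2 g ->
  (forall k, f k <= g k) -> expect f <= expect g.
Proof.
by move=> fc gc fg; rewrite /expect le_Rintegral//; exact: integrable_step.
Qed.

Lemma expect_cst r : expect (cst r) = r.
Proof.
rewrite /expect Rintegral_cst// [X in fine X](_ : _ = 1%E) ?mulr1//.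
exact: probability_setT.
Qed.

Lemma affine_growthD c1 c2 f g : affine_growth c1 f -> affine_growth c2 g ->
  affine_growth (c1 + c2) (fun k => f k + g k).
Proof.
by move=> fc gc k; rewrite mulrDl (le_trans (ler_normD _ _))// lerD.
Qed.

Lemma affine_growthB c1 c2 f g : affine_growth c1 f -> affine_growth c2 g ->
  affine_growth (c1 + c2) (fun k => f k - g k).
Proof.
by move=> fc gc k; rewrite mulrDl (le_trans (ler_normB _ _))// lerD.
Qed.

Lemma affine_growthZ c r f : affine_growth c f ->
  affine_growth (`|r| * c) (fun k => r * f k).
Proof. by move=> fc k; rewrite normrM -mulrA ler_wpM2l. Qed.

Lemma affine_growth_cst r : affine_growth `|r| (cst r).
Proof. exact: affine_growth_bounded. Qed.

Lemma affine_growth_le c f g : affine_growth c g ->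
  (forall k, `|f k| <= `|g k|) -> affine_growth c f.
Proof. by move=> gc fg k; exact: le_trans (fg k) (gc k). Qed.

Lemma le_norm_expect c f : affine_growth c f ->
  `|expect f| <= expect (fun k => `|f k|).
Proof.
by move=> fc; rewrite /expect le_normr_Rintegral//; exact: integrable_step.
Qed.

Lemma norm_expect_le B f : (forall k, `|f k| <= B) -> `|expect f| <= B.
Proof.
move=> fB; have fc := affine_growth_bounded fB.
rewrite (le_trans (le_norm_expect fc))// -[leRHS]expect_cst.
apply: le_expect fB; last exact: affine_growth_cst.
by apply: (affine_growth_le fc) => k; rewrite normr_id.
Qed.

(** The transition operator of the walk. *)
Definition shift_op (G : int -> R) (x : int) : R := expect (fun k => G (x + k)).

Lemma shift_op_bounded B G : (forall x, `|G x| <= B) ->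
  forall x, `|shift_op G x| <= B.
Proof. by move=> GB x; exact: norm_expect_le. Qed.

Lemma iter_shift_op_bounded B G m : (forall x, `|G x| <= B) ->
  forall x, `|iter m shift_op G x| <= B.
Proof. by move=> GB; elim: m => //= m; exact: shift_op_bounded. Qed.

Definition mass (a : int) : R := fine (P (X 0%N @^-1` [set a])).

Lemma expect_atom a G : expect (fun k => (k == a)%:R * G k) = mass a * G a.
Proof.
rewrite /expect /Rintegral.
under eq_integral.
  move=> w _; rewrite (_ : _%:E = ((G a)%:E * (\1_(X 0%N @^-1` [set a]) w)%:E)%E).
    over.
  rewrite indicE -EFinM; congr EFin; have [e|ne] := eqVneq (X 0%N w) a.
    by rewrite mem_set//= e mulrC.
  by rewrite memNset ?mulr0 ?mul0r//= => e; move: ne; rewrite e eqxx.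
have mA : measurable (X 0%N @^-1` [set a]) by exact: measurable_step.
rewrite integralZl//; last first.
  by rewrite -(setIT (_ @^-1` _)) integrable_indic// setIT.
by rewrite integral_indic// setIT fineM ?fin_num_measure// mulrC.
Qed.

Lemma mass_ge0 a : 0 <= mass a. Proof. exact: fine_ge0. Qed.

Lemma mass_le1 a : mass a <= 1.
Proof.
have mA : measurable (X 0%N @^-1` [set a]) by exact: measurable_step.
rewrite -lee_fin fineK ?fin_num_measure//; exact: probability_le1.
Qed.

(* With p = mass a, the left-hand side is the absolute value of the mean of
   F (x + S_m) (c + sum_{i < m} (1_{X_i = a} - p)), and by exchangeability each
   of the m terms of the sum contributes the same. The right-hand side comes
   from 2 |u| <= s + u ^ 2 / s. *)
Lemma shift_op_translate_ineq a F B (s : R) :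
  (forall x, `|F x| <= B) -> 0 < s ->
  forall m c x,
    `|c * iter m shift_op F x
      + m%:R * mass a * (iter m.-1 shift_op F (x + a) - iter m shift_op F x)|
    <= B * (s + (c ^+ 2 + m%:R) / s) / 2.
Proof.
move=> FB s0.
have B0 : 0 <= B by exact: le_trans (FB 0).
set p := mass a.
have p0 : 0 <= p by exact: mass_ge0.
have p1 : p <= 1 by exact: mass_le1.
(* Induction on the number of steps, conditioning on the first one. Both [c] and [x] must be free: a
   first step [k] replaces them by [c + xi k] and [x + k]. *)
elim=> [|m IHm] c x.
  rewrite !mul0r !addr0 /= normrM.
  apply: (@le_trans _ _ (`|c| * B)); first by rewrite ler_wpM2l.
  rewrite mulrC -mulrA ler_wpM2l// ler_pdivlMr//.
  rewrite -subr_ge0 (_ : _ - _ = (s - `|c|) ^+ 2 / s); last first.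
    by rewrite -[c ^+ 2]real_normK ?num_real//; field; rewrite gt_eqF.
  by rewrite divr_ge0 ?sqr_ge0// ltW.
set G := fun m => iter m shift_op F.
have GB n y : `|G n y| <= B by exact: iter_shift_op_bounded.
have Gg n y : affine_growth B (fun k => G n (y + k)).
  exact: affine_growth_bounded.
have Gs n y : expect (fun k => G n (y + k)) = G n.+1 y by [].
have Ga n y : affine_growth B (fun k => (k == a)%:R * G n (y + k)).
  apply: affine_growth_bounded => k; case: eqVneq => _ /=.
    by rewrite mul1r.
  by rewrite mul0r normr0.
pose xi k : R := (k == a)%:R - p.
pose V k := (c + xi k) * G m (x + k)
   + m%:R * p * (G m.-1 (x + k + a) - G m (x + k)).
pose U k := B * (s + ((c + xi k) ^+ 2 + m%:R) / s) / 2.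
have VU k : `|V k| <= U k by exact: IHm.
have atom_growth : affine_growth 1 (fun k => (k == a)%:R * 1 : R).
  by apply: affine_growth_bounded => k; case: eqVneq => _ /=;
    rewrite mulr1 ?normr1 ?normr0.
(* Averaging over the first step yields [G m (x + a)] with weight [p] from the atom and [m p] from
   the induction hypothesis. *)
have EV : expect V = c * G m.+1 x + m.+1%:R * p * (G m (x + a) - G m.+1 x).
  have -> : V = fun k => ((c - p - m%:R * p) * G m (x + k)
      + (k == a)%:R * G m (x + k)) + m%:R * p * G m.-1 (x + a + k).
    apply/funext => k; rewrite /V /xi.
    have -> : x + k + a = x + a + k by ring.
    ring.
  have g1 := affine_growthZ (c - p - m%:R * p) (Gg m x).
  have g3 := affine_growthZ (m%:R * p) (Gg m.-1 (x + a)).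
  rewrite (expectD (affine_growthD g1 (Ga m x)) g3) (expectD g1 (Ga m x)).
  rewrite !(expectZ _ (Gg _ _)) (expect_atom a (fun k => G m (x + k))) -/p !Gs.
  (* For [m = 0] the predecessor [m.-1] is again [0], which is harmless because its coefficient
     vanishes. *)
  case: m {IHm V U VU g1 g3} => [|m] /=; first by ring.
  rewrite -[in m.+2%:R]addn1 natrD; ring.
pose U0 := B * (s + ((c - p) ^+ 2 + m%:R) / s) / 2.
pose U1 := B * (1 + 2 * (c - p)) / s / 2.
have UE : U = fun k => cst U0 k + U1 * ((k == a)%:R * 1).
  apply/funext => k; rewrite /U /U0 /U1 /xi /=.
  case: eqVneq => _ /=; first by field; rewrite gt_eqF.
  by rewrite sub0r mul0r mulr0 addr0.
have Ug : affine_growth (`|U0| + `|U1| * 1) U.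
  rewrite UE; apply: affine_growthD; first exact: affine_growth_cst.
  exact: affine_growthZ.
(* The centred indicator has mean zero and variance [p (1 - p)], at most one, so a step raises the
   mean of [c ^+ 2] by at most one. *)
have EU : expect U = B * (s + (c ^+ 2 + p * (1 - p) + m%:R) / s) / 2.
  rewrite UE (expectD (affine_growth_cst _) (affine_growthZ _ atom_growth)).
  rewrite (expectZ _ atom_growth) (expect_atom a (cst 1)) -/p expect_cst.
  by rewrite /U0 /U1 /=; field; rewrite gt_eqF.
suff : `|expect V| <= B * (s + (c ^+ 2 + m.+1%:R) / s) / 2 by rewrite EV.
have Vg : affine_growth (`|U0| + `|U1| * 1) V.
  apply: (affine_growth_le Ug) => k; exact: le_trans (VU k) (ler_norm _).
apply: (le_trans (le_norm_expect Vg)).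
apply: (@le_trans _ _ (expect U)).
  by apply: (le_expect _ Ug VU); apply: (affine_growth_le Vg) => k; rewrite normr_id.
rewrite EU ler_pM2r ?invr_gt0// ler_wpM2l// lerD2l ler_pM2r ?invr_gt0//.
by rewrite -[m.+1]addn1 natrD; nra.
Qed.

(** With [c = 0], [m = r * r] and [s = r] the preceding bound is [B r], against a factor [r ^ 2 p]
    on the left. *)
Lemma shift_op_translate a F B : (forall x, `|F x| <= B) -> 0 < mass a ->
  forall r : nat, (0 < r)%N -> forall x,
  `|iter (r * r).-1 shift_op F (x + a) - iter (r * r) shift_op F x|
    <= B / mass a / r%:R.
Proof.
move=> FB p0 r r0 x; have r0' : 0 < (r%:R : R) by rewrite ltr0n.
have := shift_op_translate_ineq a FB r0' (r * r) 0 x.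
rewrite mul0r add0r normrM expr0n /= add0r natrM mulfK ?gt_eqF//.
rewrite ger0_norm => [H|]; last by rewrite !mulr_ge0// ltW.
rewrite ler_pdivlMr// ler_pdivlMr// -(ler_pM2r r0').
set D := `|_|; rewrite -/D in H; lra.
Qed.

End step_expectation.

(** * Convergence of sequences along polynomially growing times *)

Lemma squeeze_cvg0 (R : realType) (u v : nat -> R) :
  (\forall n \near \oo, `|u n| <= v n) ->
  v n @[n --> \oo] --> 0 -> u n @[n --> \oo] --> 0.
Proof.
move=> uv v0; apply/cvgr0Pnorm_le => e e0.
have /cvgr0Pnorm_le/(_ e e0) := v0.
by apply: filterS2 uv => n uv ve; rewrite (le_trans uv)// (le_trans (ler_norm _)).
Qed.

Lemma nat_block (N : nat -> nat) (J n : nat) :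
  (forall j, (j < N j)%N) -> {homo N : i j / (i <= j)%N >-> (i <= j)%N} ->
  (N J <= n)%N -> exists2 j, (J <= j)%N & (N j <= n < N j.+1)%N.
Proof.
move=> Ngt Nhomo Jn.
have ex : exists m, (n < N m)%N by exists n.
case: (ex_minnP ex) => -[|m] nm mmin.
  by move: Jn; rewrite leqNgt (leq_trans nm)// Nhomo.
have Nm : (N m <= n)%N.
  by rewrite leqNgt; apply/negP => /mmin; rewrite ltnn.
exists m; last by rewrite Nm nm.
by rewrite leqNgt; apply/negP => /Nhomo; rewrite leqNgt (leq_trans _ nm).
Qed.

Lemma cvg_shifted_power_ratio (R : realType) (q : nat) :
  ((j.+2 ^ q)%N%:R / (j.+1 ^ q)%N%:R : R) @[j --> \oo] --> (1 : R).
Proof.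
have -> : (fun j => (j.+2 ^ q)%N%:R / (j.+1 ^ q)%N%:R : R) =
    (fun j => (1 + j.+1%:R^-1) ^+ q).
  apply/funext => j; rewrite !natrX -expr_div_n; congr (_ ^+ _).
  by rewrite -[j.+2]addn1 natrD; field.
have h : (1 + j.+1%:R^-1 : R) @[j --> \oo] --> (1 : R).
  rewrite -[X in _ --> X]addr0; apply: cvgD; first exact: cvg_cst.
  exact: cvg_harmonic.
rewrite -[X in _ --> X](expr1n R q).
exact: (cvg_comp _ _ h (@exprn_continuous R q 1)).
Qed.

(* A difference of two nondecreasing sequences, one of which is Lipschitz,
   cannot oscillate between the times [j ^ q], whose ratios tend to [1]. *)
Lemma cvg_along_powers (R : realType) (a b : nat -> R) (B : R) (q : nat) :
  (0 < q)%N ->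
  {homo a : i j / (i <= j)%N >-> i <= j} ->
  {homo b : i j / (i <= j)%N >-> i <= j} ->
  (forall i j, (i <= j)%N -> b j <= b i + B * (j - i)%:R) -> 0 <= B ->
  (a (j.+1 ^ q)%N - b (j.+1 ^ q)%N) / (j.+1 ^ q)%N%:R @[j --> \oo] --> 0 ->
  (a n - b n) / n%:R @[n --> \oo] --> 0.
Proof.
move=> q0 ha hb hB B0 h; pose N j := (j.+1 ^ q)%N.
have Ngt j : (j < N j)%N by rewrite -[X in (X <= _)%N]expn1 leq_pexp2l.
have Nhomo : {homo N : i j / (i <= j)%N >-> (i <= j)%N}.
  by move=> i j ij; rewrite leq_exp2r.
have N0 j : 0 < (N j)%:R :> R by rewrite ltr0n (leq_ltn_trans _ (Ngt j)).
apply/cvgr0Pnorm_le => e e0.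
(* The bound [1] keeps the ratio of consecutive large times below two; [(2 + B) e1 <= e] absorbs the
   final error [2 e1 n + B e1 n]. *)
pose e1 := Num.min 1 (e / (2 + B)).
have B2 : 0 < 2 + B by rewrite ltr_wpDr.
have e10 : 0 < e1 by rewrite lt_min ltr01 divr_gt0.
have e11 : e1 <= 1 by rewrite ge_min lexx.
have e1e : (2 + B) * e1 <= e.
  by rewrite mulrC -ler_pdivlMr// ge_min lexx orbT.
move/cvgr0Pnorm_le : h => /(_ e1 e10) [J1 _ hJ1].
have /cvgrPdist_le/(_ e1 e10) [J2 _ hJ2] := @cvg_shifted_power_ratio R q.
exists (N (maxn J1 J2)) => // n /= Jn.
have [j] := nat_block Ngt Nhomo Jn.
rewrite geq_max => /andP[J1j J2j] /andP[Njn nNj1].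
have nj : (N j)%:R <= n%:R :> R by rewrite ler_nat.
have n0 : 0 < n%:R :> R by exact: lt_le_trans (N0 j) nj.
have D j' : (J1 <= j')%N -> `|a (N j') - b (N j')| <= e1 * (N j')%:R.
  by move=> /hJ1; rewrite /= normrM normfV (ger0_norm (ltW (N0 j'))) ler_pdivrMr.
have Nr : (N j.+1)%:R <= (1 + e1) * (N j)%:R :> R.
  have := hJ2 j J2j; rewrite /= ler_distl => /andP[+ _].
  by rewrite -ler_pdivrMr// lerBlDr.
have Nj1 : b (N j.+1) - b (N j) <= B * e1 * n%:R.
  have /hB : (N j <= N j.+1)%N by exact: Nhomo.
  rewrite -lerBlDl => /le_trans -> //; rewrite -mulrA ler_wpM2l//.
  rewrite natrB ?Nhomo// lerBlDr (le_trans Nr)// mulrDl mul1r addrC lerD2r.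
  by apply: ler_wpM2l => //; exact: ltW.
have D1 := D j J1j; have D2 := D j.+1 (leqW J1j).
have D1' : e1 * (N j)%:R <= e1 * n%:R by apply: ler_wpM2l => //; exact: ltW.
have D2' : e1 * (N j.+1)%:R <= 2 * e1 * n%:R.
  rewrite (_ : 2 * e1 * n%:R = e1 * (2 * n%:R)); last by ring.
  apply: ler_wpM2l; first exact: ltW.
  apply: (le_trans Nr); apply: (@le_trans _ _ (2 * (N j)%:R)).
    by rewrite ler_wpM2r// -[leRHS]/(1 + 1) lerD2l.
  by rewrite ler_wpM2l.
have en : (2 + B) * e1 * n%:R <= e * n%:R by rewrite ler_wpM2r.
rewrite normrM normfV (ger0_norm (ltW n0)) ler_pdivrMr//.
(* By monotonicity [a n - b n] lies between [a (N j) - b (N j.+1)] and [a (N j.+1) - b (N j)]. *)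
have a1 := ha _ _ Njn; have a2 := ha _ _ (ltnW nNj1).
have b1 := hb _ _ Njn; have b2 := hb _ _ (ltnW nNj1).
move: D1 D2; rewrite !ler_norml => /andP[D11 D12] /andP[D21 D22].
have e1n : 0 <= e1 * n%:R by apply: mulr_ge0; exact: ltW.
by apply/andP; split; lra.
Qed.

(** * Almost sure convergence from summable means *)

Section ae_summable.
Context d (T : measurableType d) (R : realType) (P : {measure set T -> \bar R}).

(** The sum of all [Y n] has a finite integral, so it is finite almost everywhere and its terms tend
    to zero. Applied to counts of rare events this is the Borel-Cantelli lemma. *)
Lemma ae_cvg0_summable (Y : nat -> T -> R) (K : R) :
  (forall n, measurable_fun setT (Y n)) -> (forall n w, 0 <= Y n w) ->
  (forall n, \sum_(0 <= j < n) \int[P]_w (Y j w)%:E <= K%:E)%E ->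
  {ae P, forall w, Y n w @[n --> \oo] --> 0}.
Proof.
move=> mY Y0 YK.
pose S w : \bar R := (\sum_(j <oo) (Y j w)%:E)%E.
have mYE j : measurable_fun setT (fun w => (Y j w)%:E) by exact/measurable_EFinP.
have YE0 j w : setT w -> (0 <= (Y j w)%:E)%E by rewrite lee_fin.
have S0 w : (0 <= S w)%E by apply: nneseries_ge0 => j _ _; exact: YE0.
have mS : measurable_fun setT S 
  by apply: (@ge0_emeasurable_sum _ _ _ _ (fun j w => (Y j w)%:E) xpredT) => *;
    [exact: YE0|exact: mYE].
have iS : P.-integrable setT S.
  apply/integrableP; split=> //.
  under eq_integral do rewrite gee0_abs//.
  rewrite integral_nneseries//; apply: (@le_lt_trans _ _ K%:E); last by rewrite ltry.
  apply: lime_le; last by apply: nearW => n; exact: YK.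
  by apply: is_cvg_nneseries => j _ _; apply: integral_ge0 => w; exact: YE0.
have := integrable_ae measurableT iS; apply: filterS => w /(_ I) Sfin.
apply: cvg_series_cvg_0; apply: nondecreasing_is_cvgn.
  by apply: nondecreasing_series => j _ _; exact: Y0.
exists (fine (S w)) => _ [n _ <-].
rewrite -lee_fin fineK// /series/= -sumEFin.
by apply: nneseries_lim_ge => j _ _; exact: YE0.
Qed.

End ae_summable.

(** * Compensated sums and their second moments *)

Section compensated_sums.
Context d (T : measurableType d) (R : realType) (P : probability T R).
Context (X : nat -> {RV P >-> int}).
Hypothesis Xiid : iid X.
Hypothesis X_int : P.-integrable setT (fun w => ((X 0%N w)%:~R : R)%:E).

Lemma EFin_expect c (f : int -> R) : affine_growth c f ->
  (expect X f)%:E = (\int[P]_w (f (X 0%N w))%:E)%E.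
Proof.
move=> fc; rewrite /expect /Rintegral fineK//.
by apply: integrable_fin_num => //; exact: (integrable_step X_int fc).
Qed.

Lemma expect_cvg0 c (f : nat -> int -> R) : (forall n, affine_growth c (f n)) ->
  (forall k, f n k @[n --> \oo] --> 0) ->
  expect X (f n) @[n --> \oo] --> 0.
Proof.
move=> fc f0.
have gc : affine_growth c (fun k : int => c * (1 + `|k%:~R|) : R).
  move=> k; have := fc 0%N k => /(le_trans (normr_ge0 _)) h.
  by rewrite ger0_norm.
have [] := @dominated_convergence _ _ _ P _ (@measurableT _ _)
  (fun n w => (f n (X 0%N w))%:E) (cst 0%E)
  (fun w => (c * (1 + `|(X 0%N w)%:~R|))%:E).
- by move=> n; apply: (@measurable_fun_step _ _ _ _ X _ _ _ (EFin \o f n)).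
- exact: measurable_cst.
- by apply: aeW => w _; apply: cvg_EFin (f0 _); exact: nearW.
- exact: (integrable_step X_int gc).
- by apply: aeW => w n _ /=; rewrite lee_fin; exact: fc.
move=> _ _; rewrite integral0 => h.
exact: (fine_cvg h).
Qed.

(** Each increment is reduced by its conditional mean given the past, which makes this a martingale
    along the walk when the increments are integrable. *)
Fixpoint compensated (phi : int -> int -> R) (s : seq int) : R :=
  if s is k :: s' then
    compensated phi s' + (phi (position s') k - expect X (phi (position s')))
  else 0.

Lemma compensatedE phi n w : compensated phi (hist X n w) =
  \sum_(i < n) (phi (walk X i w) (X i w) - expect X (phi (walk X i w))).
Proof.
elim: n => [|n IHn] /=; first by rewrite big_ord0.
by rewrite big_ord_recr /= -IHn !walkE.
Qed.

(** Martingale increments are orthogonal: given the history, the cross term has mean zero and the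
    variance of the new term is at most [V]. *)
Lemma second_moment_compensated (phi : int -> int -> R) (b V : R) n :
  (forall x k, `|phi x k| <= b) ->
  (forall x, expect X (fun k => phi x k ^+ 2) <= V) ->
  (\int[P]_w ((compensated phi (hist X n w)) ^+ 2)%:E <= (n%:R * V)%:E)%E.
Proof.
move=> phib phiV.
have V0 : 0 <= V.
  by apply: le_trans (phiV 0); apply: Rintegral_ge0 => w _; exact: sqr_ge0.
elim: n => [|n IHn]; first by rewrite /= expr0n /= integral0 mul0r.
rewrite (ge0_integral_hist_step Xiid n
  (h := fun s k => (compensated phi (k :: s) ^+ 2)%:E)); last first.
  by move=> s k; rewrite lee_fin sqr_ge0.
apply: (@le_trans _ _
    (\int[P]_w ((compensated phi (hist X n w) ^+ 2)%:E + V%:E))%E).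
  apply: ge0_le_integral => //.
  - by move=> w _; apply: integral_ge0 => w' _; rewrite lee_fin sqr_ge0.
  - exact: (@measurable_fun_hist _ _ _ _ X _ _ _ (fun s =>
      \int[P]_w' (compensated phi (X 0%N w' :: s) ^+ 2)%:E)%E).
  - exact: (@measurable_fun_hist _ _ _ _ X _ _ _ (fun s =>
      (compensated phi s ^+ 2)%:E + V%:E)%E).
  move=> w _ /=; set s := hist X n w; set M := compensated phi s.
  set e := expect X (phi (position s)).
  have g0 : affine_growth b (phi (position s)).
    exact: affine_growth_bounded.
  have g1 : affine_growth (b ^+ 2) (fun k => phi (position s) k ^+ 2).
    apply: affine_growth_bounded => k; rewrite normrX.
    by rewrite lerXn2r ?nnegrE// (le_trans _ (phib 0 0)).
  have g2 := affine_growthZ (2 * (M - e)) g0.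
  have g3 := affine_growthD (affine_growth_cst ((M - e) ^+ 2)) g2.
  have g4 := affine_growthD g3 g1.
  (* Expanded so that the mean is [M ^+ 2 - e ^+ 2 + q], where [q] is the second moment of
     [phi (position s)] and at most [V]. *)
  have -> : (fun w' => ((M + (phi (position s) (X 0%N w') - e)) ^+ 2)%:E) =
      (fun w' => ((M - e) ^+ 2 + 2 * (M - e) * phi (position s) (X 0%N w')
          + phi (position s) (X 0%N w') ^+ 2)%:E).
    by apply/funext => w'; congr EFin; ring.
  rewrite -(EFin_expect g4) (expectD X_int g3 g1).
  rewrite (expectD X_int (affine_growth_cst _) g2) (expectZ X_int _ g0).
  rewrite -/e expect_cst -EFinD lee_fin.
  have := phiV (position s); have := sqr_ge0 e.
  set q := expect X _; rewrite !expr2; lra.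
rewrite ge0_integralD//; last 2 first.
- by move=> w _; rewrite lee_fin sqr_ge0.
- exact: (@measurable_fun_hist _ _ _ _ X _ _ _ (fun s =>
      (compensated phi s ^+ 2)%:E)).
rewrite integral_cst// [X in (_ * X)%E](_ : _ = 1%E); last exact: probability_setT.
by rewrite mule1 -[in leRHS]addn1 natrD mulrDl mul1r EFinD leeD2r.
Qed.

End compensated_sums.

(** * The strong law for controlled increments *)

Lemma absz_intr (R : realType) (k : int) : `|k%:~R| = (`|k|%N)%:R :> R.
Proof. by rewrite natr_absz intr_norm. Qed.

Lemma sum_inv_square_le (R : realType) n :
  \sum_(0 <= j < n) (j.+1%:R ^- 2 : R) <= 2.
Proof.
(* This sharper bound is what carries the induction. *)
apply: (@le_trans _ _ (2 - 2 / n.+1%:R)); last by rewrite gerBl.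
elim: n => [|n IHn]; first by rewrite big_nil divr1 subrr.
rewrite big_nat_recr//= (le_trans (lerD IHn (lexx _)))//.
set y : R := n.+1%:R; have y1 : 1 <= y by rewrite ler1n.
have -> : n.+2%:R = y + 1 :> R by rewrite -[n.+2]addn1 natrD.
rewrite -subr_ge0 (_ : _ - _ = (y - 1) / (y ^+ 2 * (y + 1))); last by field; lra.
by rewrite divr_ge0 ?mulr_ge0 ?sqr_ge0//; lra.
Qed.

Section strong_law.
Context d (T : measurableType d) (R : realType) (P : probability T R).
Context (X : nat -> {RV P >-> int}) (C beta : R).
Hypothesis Xiid : iid X.
Hypothesis X_int : P.-integrable setT (fun w => ((X 0%N w)%:~R : R)%:E).
Hypothesis C0 : 0 < C.
Hypothesis beta1 : 1 < beta.
Hypothesis X_tail : forall t : R, 1 <= t ->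
  (P [set w | (t < `|(X 0%N w)%:~R|)%R] <= (C / t `^ beta)%:E)%E.

(** The condition on [r] says [r beta >= (r + 2) + 2]: even after multiplication by the number
    [j.+1 ^ (r + 2)] of steps considered, the probability of exceeding [j.+1 ^ r] is summable in
    [j]. *)
Lemma measure_large_step (r j i : nat) : 4 <= r%:R * (beta - 1) ->
  (P (X i @^-1` [set k | (j.+1 ^ r < `|k|)%N])
    <= (C * j.+1%:R ^- 2 / (j.+1 ^ (r + 2))%N%:R)%:E)%E.
Proof.
move=> r4; have [_ idd] := Xiid.
set y : R := j.+1%:R; have y1 : 1 <= y by rewrite ler1n.
have y0 : 0 < y by exact: lt_le_trans y1.
have -> : P (X i @^-1` [set k | (j.+1 ^ r < `|k|)%N]) =
          P (X 0%N @^-1` [set k | (j.+1 ^ r < `|k|)%N]) by exact: idd.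
have -> : X 0%N @^-1` [set k | (j.+1 ^ r < `|k|)%N] =
    [set w | y ^+ r < `|(X 0%N w)%:~R|].
  by apply/seteqP; split=> w /=; rewrite absz_intr -natrX ltr_nat.
apply: (le_trans (X_tail _)); first exact: exprn_ege1.
rewrite lee_fin natrX -/y -[leRHS]mulrA; apply: ler_wpM2l; first exact: ltW.
rewrite -invfM lef_pV2 ?posrE; last 2 first.
- by rewrite powR_gt0// exprn_gt0.
- by rewrite mulr_gt0// exprn_gt0.
rewrite -exprD -!powR_mulrn ?(ltW y0)// -powRrM ler_powR//.
rewrite addnCA natrD; lra.
Qed.

Definition truncate (m : nat) (phi : int -> int -> R) (x k : int) : R :=
  if (`|k| <= m)%N then phi x k else 0.

Lemma truncate_le m phi x k : `|truncate m phi x k| <= `|phi x k|.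
Proof. by rewrite /truncate; case: ifP; rewrite ?normr0. Qed.

Lemma truncate_bounded c m phi x k : affine_growth c (phi x) ->
  `|truncate m phi x k| <= c * (1 + m%:R).
Proof.
move=> phic; have c0 : 0 <= c.
  by have := phic 0; rewrite normr0 addr0 mulr1; exact: le_trans.
rewrite /truncate; case: ifPn => km; last by rewrite normr0 mulr_ge0.
apply: (le_trans (phic k)); rewrite ler_wpM2l// lerD2l absz_intr ler_nat//.
Qed.

Let A : R := expect X (fun k => 1 + `|k%:~R|).

Let growth1 : affine_growth 1 (fun k => 1 + `|k%:~R| : R).
Proof. by move=> k; rewrite mul1r ger0_norm. Qed.

(** One factor of the square is bounded through the truncation level, the other by [c (1 + |k|)], so
    only the first moment [A] enters. *)
Lemma truncate_second_moment c m phi x : affine_growth c (phi x) ->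
  expect X (fun k => truncate m phi x k ^+ 2) <= c ^+ 2 * (1 + m%:R) * A.
Proof.
move=> phic; have c0 : 0 <= c.
  by have := phic 0; rewrite normr0 addr0 mulr1; exact: le_trans.
rewrite -(expectZ X_int _ growth1).
have h k : truncate m phi x k ^+ 2 <= c ^+ 2 * (1 + m%:R) * (1 + `|k%:~R|).
  rewrite -real_normK ?num_real// expr2.
  rewrite (_ : _ * _ * _ = (c * (1 + m%:R)) * (c * (1 + `|k%:~R|))); last by ring.
  rewrite ler_pM// ?truncate_bounded//.
  exact: le_trans (truncate_le _ _ _ _) (phic k).
have g := affine_growthZ (c ^+ 2 * (1 + m%:R)) growth1.
apply: (le_expect X_int _ g h); apply: (affine_growth_le g) => k.
by rewrite ger0_norm ?sqr_ge0// (le_trans (h k))// ler_norm.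
Qed.

(** Up to time [N j = j.+1 ^ (r + 2)] steps are truncated at [M j = j.+1 ^ r]. The normalized
    truncated sum has second moment of order [M j / N j = j.+1 ^- 2], and so has the expected number
    of larger steps; both are summable. *)
Lemma slln_along_powers c (phi : int -> int -> R) (r : nat) :
  4 <= r%:R * (beta - 1) -> (0 < r)%N ->
  (forall x, affine_growth c (phi x)) ->
  {ae P, forall w, compensated X phi (hist X (j.+1 ^ (r + 2)) w)
      / (j.+1 ^ (r + 2))%N%:R @[j --> \oo] --> 0}.
Proof.
move=> r4 r0 phic.
have c0 : 0 <= c.
  by have := phic 0 0; rewrite normr0 addr0 mulr1; exact: le_trans.
pose N j := (j.+1 ^ (r + 2))%N; pose M j := (j.+1 ^ r)%N.
pose phi_ j := truncate (M j) phi.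
pose Z j w := compensated X (phi_ j) (hist X (N j) w) / (N j)%:R.
pose large j i w : R := (M j < `|X i w|)%N%:R.
(* One nonnegative variable controls both the truncated sum and the number of large steps. *)
pose Y j w := Z j w ^+ 2 + \sum_(i < N j) large j i w.
have N0 j : 0 < (N j)%:R :> R by rewrite ltr0n expn_gt0.
have M1 j : 1 <= (M j)%:R :> R by rewrite ler1n expn_gt0.
have NM j : (N j)%:R = (M j)%:R * j.+1%:R ^+ 2 :> R.
  by rewrite /N expnD natrM [in X in _ * X]natrX.
have A0 : 0 <= A by apply: Rintegral_ge0 => w _; rewrite addr_ge0.
have mlarge j i : measurable_fun setT (large j i).
  exact: (@measurable_fun_step _ _ _ _ X _ _ _ (fun k => (M j < `|k|)%N%:R : R)).
have mZ j : measurable_fun setT (Z j).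
  exact: (@measurable_fun_hist _ _ _ _ X _ _ _
    (fun s => compensated X (phi_ j) s / (N j)%:R)).
have large0 j i w : 0 <= large j i w by exact: ler0n.
have Y0 j w : 0 <= Y j w by rewrite /Y addr_ge0 ?sqr_ge0// sumr_ge0.
have mY j : measurable_fun setT (Y j).
  apply: measurable_funD; first exact: measurable_funX.
  by apply: measurable_sum => i; exact: mlarge.
pose K := 2 * c ^+ 2 * A + C.
have K0 : 0 <= K.
  by rewrite /K addr_ge0 ?(ltW C0)// mulr_ge0// mulr_ge0// sqr_ge0.
have int_large j i : (\int[P]_w (large j i w)%:E
    <= (C * j.+1%:R ^- 2 / (N j)%:R)%:E)%E.
  rewrite (eq_integral (fun w => (\1_(X i @^-1` [set k | (M j < `|k|)%N]) w)%:E)).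
    rewrite integral_indic// ?setIT; first exact: measure_large_step.
    exact: measurable_step.
  move=> w _; rewrite /large indicE; congr (_%:R%:E); congr nat_of_bool.
  by apply/idP/idP => [h|]; [rewrite mem_set|rewrite inE].
have int_Z j : (\int[P]_w (Z j w ^+ 2)%:E
    <= (2 * c ^+ 2 * A * j.+1%:R ^- 2)%:E)%E.
  under eq_integral do rewrite /Z expr_div_n mulrC EFinM.
  rewrite ge0_integralZl//; last 2 first.
  - exact: (@measurable_fun_hist _ _ _ _ X _ _ _
      (fun s => (compensated X (phi_ j) s ^+ 2)%:E)).
  - by move=> w _; rewrite lee_fin sqr_ge0.
  have b := fun x k => truncate_bounded (M j) k (phic x).
  have v := fun x => truncate_second_moment (M j) (phic x).
  apply: le_trans (lee_wpmul2l _ (second_moment_compensated Xiid X_int (N j) b v)) _.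
    by rewrite lee_fin invr_ge0 sqr_ge0.
  rewrite -EFinM lee_fin.
  have cancel (n y : R) : 0 < n -> n ^- 2 * (n * y) = y / n.
    by move=> n0; field; rewrite gt_eqF.
  rewrite cancel// ler_pdivrMr// NM.
  have arith (m y : R) : 0 < y -> 1 <= m ->
      c ^+ 2 * (1 + m) * A <= 2 * c ^+ 2 * A * y ^- 2 * (m * y ^+ 2).
    move=> y0 m1; rewrite (_ : 2 * _ * _ * _ * _ = c ^+ 2 * A * (2 * m)); last first.
      by field; rewrite gt_eqF.
    rewrite mulrAC; apply: ler_wpM2l; last by lra.
    by rewrite mulr_ge0// sqr_ge0.
  exact: arith.
have int_Y j : (\int[P]_w (Y j w)%:E <= (K * j.+1%:R ^- 2)%:E)%E.
  under eq_integral do rewrite /Y EFinD -sumEFin.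
  rewrite ge0_integralD//; last 4 first.
  - by move=> w _; rewrite lee_fin sqr_ge0.
  - by apply/measurable_EFinP; exact: measurable_funX.
  - by move=> w _; rewrite sume_ge0// => i _; rewrite lee_fin.
  - by apply: emeasurable_sum => i; exact/measurable_EFinP.
  rewrite /K mulrDl EFinD; apply: leeD; first exact: int_Z.
  rewrite ge0_integral_sum//; last 2 first.
  - by move=> i; exact/measurable_EFinP.
  - by move=> i w _; rewrite lee_fin.
  apply: (@le_trans _ _ (\sum_(i < N j) (C * j.+1%:R ^- 2 / (N j)%:R)%:E)%E).
    by apply: lee_sum => i _; exact: int_large.
  rewrite sumEFin sumr_const card_ord lee_fin -[_ *+ _]mulr_natr.
  by rewrite mulfVK// gt_eqF.
have Ysum n : (\sum_(0 <= j < n) \int[P]_w (Y j w)%:E <= (K * 2)%:E)%E.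
  apply: (@le_trans _ _ (\sum_(0 <= j < n) (K * j.+1%:R ^- 2)%:E)%E).
    by apply: lee_sum => j _; exact: int_Y.
  by rewrite sumEFin lee_fin -mulr_sumr ler_wpM2l// sum_inv_square_le.
have := ae_cvg0_summable mY Y0 Ysum; apply: filterS => w Yw.
(* Dominates, uniformly in the position, what truncation removes from [phi]; its mean tends to zero
   by dominated convergence. *)
pose tail j (k : int) : R := if (`|k| <= M j)%N then 0 else c * (1 + `|k%:~R|).
have tailc j : affine_growth c (tail j).
  move=> k; rewrite /tail; case: ifP => _; first by rewrite normr0 mulr_ge0.
  by rewrite ger0_norm// mulr_ge0.
have tail0 : expect X (tail j) @[j --> \oo] --> 0.
  apply: (expect_cvg0 X_int tailc) => k.
  apply: cvg_near_cst; exists `|k|%N => // j /= kj.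
  rewrite /tail (leq_trans kj)// /M (leq_trans (leqnSn j))//.
  by rewrite -[X in (X <= _)%N]expn1 leq_pexp2l.
have Z0 : Z j w @[j --> \oo] --> 0.
  apply/cvgr0Pnorm_le => e e0.
  move/cvgr0Pnorm_le : Yw => /(_ (e ^+ 2) (exprn_gt0 _ e0)).
  apply: filterS => j; rewrite ger0_norm// => Ye.
  rewrite -(@ler_pXn2r _ 2)// ?nnegrE ?(ltW e0)// real_normK ?num_real//.
  by apply: le_trans Ye; rewrite lerDl sumr_ge0.
have /cvgr0Pnorm_lt/(_ 1 ltr01) Y1 := Yw.
apply: (@squeeze_cvg0 _ _ (fun j => `|Z j w| + expect X (tail j))); last first.
  rewrite -[X in _ --> X]addr0; apply: cvgD => //.
  by rewrite -(@normr0 _ R); exact: cvg_norm.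
apply: filterS Y1 => j; rewrite ger0_norm// => Yj1.
(* A number of large steps below [1] is zero, so truncation leaves the first [N j] steps
   untouched. *)
have small i : (i < N j)%N -> (`|X i w| <= M j)%N.
  move=> iN; rewrite leqNgt; apply/negP => lg; move: Yj1; apply/negP.
  rewrite -leNgt /Y (bigD1 (Ordinal iN))//= /large lg addrCA lerDl.
  by rewrite addr_ge0 ?sqr_ge0// sumr_ge0.
have diff i : `|expect X (phi (walk X i w)) - expect X (phi_ j (walk X i w))|
    <= expect X (tail j).
  have gt : affine_growth c (phi_ j (walk X i w)).
    by apply: (affine_growth_le (phic (walk X i w))) => k; exact: truncate_le.
  rewrite -(expectB X_int (phic _) gt).
  have gB := affine_growthB (phic (walk X i w)) gt.
  apply: le_trans (le_norm_expect X_int gB) _.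
  apply: (le_expect X_int _ (tailc j)).
    by apply: (affine_growth_le gB) => k; rewrite normr_id.
  move=> k; rewrite /phi_ /truncate /tail; case: ifP => _.
    by rewrite subrr normr0.
  by rewrite subr0; exact: phic.
rewrite normrM normfV (ger0_norm (ltW (N0 j))) ler_pdivrMr// mulrDl.
rewrite /Z normrM normfV (ger0_norm (ltW (N0 j))) mulfVK ?gt_eqF//.
rewrite -lerBlDl; apply: le_trans (lerB_dist _ _) _.
rewrite !compensatedE -sumrB; apply: le_trans (ler_norm_sum _ _ _) _.
apply: (@le_trans _ _ (\sum_(i < N j) expect X (tail j))); last first.
  by rewrite sumr_const card_ord mulr_natr.
apply: ler_sum => i _.
rewrite (_ : phi_ j (walk X i w) (X i w) = phi (walk X i w) (X i w)); last first.
  by rewrite /phi_ /truncate small.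
rewrite [X in `|X|](_ : _ = expect X (phi_ j (walk X i w)) -
  expect X (phi (walk X i w))); first by rewrite distrC.
by ring.
Qed.

(** For [phi >= 0] the partial sums and their compensators are nondecreasing, and the compensators
    grow by at most [B] per step, so convergence along powers extends to all times. *)
Lemma slln_nonneg c (phi : int -> int -> R) :
  (forall x k, 0 <= phi x k) -> (forall x, affine_growth c (phi x)) ->
  {ae P, forall w, compensated X phi (hist X n w) / n%:R @[n --> \oo] --> 0}.
Proof.
move=> phi0 phic.
have [r r4 r0] : exists2 r : nat, 4 <= r%:R * (beta - 1) & (0 < r)%N.
  exists (Num.bound (4 / (beta - 1))).+1 => //.
  rewrite -ler_pdivrMr ?subr_gt0//.
  have q0 : 0 <= 4 / (beta - 1) by rewrite divr_ge0// subr_ge0 ltW.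
  by apply: le_trans (ltW (archi_boundP q0)) _; rewrite ler_nat.
have := slln_along_powers r4 r0 phic; apply: filterS => w h.
have e0 i : 0 <= expect X (phi (walk X i w)) by exact: Rintegral_ge0.
pose a n := \sum_(0 <= i < n) phi (walk X i w) (X i w).
pose b n := \sum_(0 <= i < n) expect X (phi (walk X i w)).
have abE n : compensated X phi (hist X n w) = a n - b n.
  by rewrite compensatedE /a /b -sumrB big_mkord.
under eq_fun do rewrite abE.
pose B := expect X (fun k => c * (1 + `|k%:~R|)).
have c0 : 0 <= c.
  by have := phic 0 0; rewrite normr0 addr0 mulr1; exact: le_trans.
have eB i : expect X (phi (walk X i w)) <= B.
  have g : affine_growth c (fun k : int => c * (1 + `|k%:~R|) : R).
    by move=> k; rewrite ger0_norm// mulr_ge0.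
  apply: (le_expect X_int (phic _) g) => k; exact: le_trans (ler_norm _) (phic _ k).
apply: (@cvg_along_powers _ a b B (r + 2)); first by rewrite addn2.
- move=> i j ij; rewrite /a (big_cat_nat (leq0n i) ij)/= lerDl.
  by apply: sumr_ge0.
- move=> i j ij; rewrite /b (big_cat_nat (leq0n i) ij)/= lerDl.
  by apply: sumr_ge0.
- move=> i j ij; rewrite /b (big_cat_nat (leq0n i) ij)/= lerD2l.
  apply: (@le_trans _ _ (\sum_(i <= l < j) B)); first exact: ler_sum.
  by rewrite sumr_const_nat mulr_natr.
- exact: le_trans (e0 0%N) (eB 0%N).
- by under eq_fun do rewrite -abE.
Qed.

(** Positive and negative parts are treated separately, since monotone partial sums require a
    sign. *)
Lemma slln c (phi : int -> int -> R) : (forall x, affine_growth c (phi x)) ->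
  {ae P, forall w,
    (\sum_(i < n) (phi (walk X i w) (X i w) - expect X (phi (walk X i w)))) / n%:R
      @[n --> \oo] --> 0}.
Proof.
move=> phic.
pose p x k := Num.max (phi x k) 0; pose m x k := Num.max (- phi x k) 0.
have pm x k : phi x k = p x k - m x k.
  by rewrite /p /m /Num.max; case: ltP => h1; case: ltP => h2; lra.
have pc x : affine_growth c (p x).
  apply: (affine_growth_le (phic x)) => k; rewrite /p /Num.max.
  by case: ltP; rewrite ?normr0.
have mc x : affine_growth c (m x).
  apply: (affine_growth_le (phic x)) => k; rewrite /m /Num.max.
  by case: ltP; rewrite ?normr0 ?normrN.
have p0 x k : 0 <= p x k by rewrite /p le_max lexx orbT.
have m0 x k : 0 <= m x k by rewrite /m le_max lexx orbT.
apply: filterS2 (slln_nonneg p0 pc) (slln_nonneg m0 mc) => w hp hm.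
rewrite -[X in _ --> X](subrr 0); under eq_fun.
  move=> n; rewrite (_ : _ / _ = compensated X p (hist X n w) / n%:R
      - compensated X m (hist X n w) / n%:R); first over.
  rewrite !compensatedE -mulrBl -sumrB; congr (_ / _); apply: eq_bigr => i _.
  rewrite pm (_ : phi _ = fun k => p (walk X i w) k - m (walk X i w) k).
    by rewrite (expectB X_int (pc _) (mc _)); ring.
  by apply/funext => k; exact: pm.
exact: cvgB.
Qed.

End strong_law.

(** * Functions with equal averages along the walk *)

Lemma cvg_bounded_div (R : realType) (u : nat -> R) (B : R) :
  (forall n, `|u n| <= B) -> u n / n%:R @[n --> \oo] --> 0.
Proof.
move=> uB; apply: (@squeeze_cvg0 _ _ (fun n => B * n%:R^-1)).
  apply: nearW => n; rewrite normrM normfV (ger0_norm (ler0n _ _)).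
  by rewrite ler_wpM2r// invr_ge0.
rewrite -[X in _ --> X](mulr0 B); apply: cvgMr.
apply: ((@gtr0_cvgV0 _ _ _ _ (fun n => n%:R : R) _).2 (@cvgr_idn R)).
by exists 1%N => // n /=; rewrite ltr0n.
Qed.

Section equivalence_in_average.
Context d (T : measurableType d) (R : realType) (P : probability T R).
Context (X : nat -> {RV P >-> int}) (C beta : R).
Hypothesis Xiid : iid X.
Hypothesis X_int : P.-integrable setT (fun w => ((X 0%N w)%:~R : R)%:E).
Hypothesis C0 : 0 < C.
Hypothesis beta1 : 1 < beta.
Hypothesis X_tail : forall t : R, 1 <= t ->
  (P [set w | (t < `|(X 0%N w)%:~R|)%R] <= (C / t `^ beta)%:E)%E.

Definition avg_equiv (G H : int -> R) :=
  {ae P, forall w,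
    (\sum_(i < n) (G (walk X i w) - H (walk X i w))) / n%:R @[n --> \oo] --> 0}.

Lemma avg_equiv_refl G : avg_equiv G G.
Proof.
apply: aeW => w; rewrite (_ : (fun n => _) = cst 0); first exact: cvg_cst.
by apply/funext => n; rewrite big1 ?mul0r// => i _; rewrite subrr.
Qed.

Lemma avg_equiv_sym G H : avg_equiv G H -> avg_equiv H G.
Proof.
apply: filterS => w h; rewrite -[X in _ --> X]oppr0.
under eq_fun do under eq_bigr do rewrite -opprB.
under eq_fun do rewrite sumrN mulNr.
exact: cvgN.
Qed.

Lemma avg_equiv_trans H G K : avg_equiv G H -> avg_equiv H K -> avg_equiv G K.
Proof.
apply: filterS2 => w h1 h2; rewrite -[X in _ --> X](addr0 0).
under eq_fun => n do under eq_bigr => i _ do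
  rewrite -(subrK (H (walk X i w)) (G (walk X i w))) -addrA.
under eq_fun do rewrite big_split mulrDl.
exact: cvgD.
Qed.

(** Errors [1 / (m + 1)] suffice, so only countably many null sets are discarded; for each [m] the
    averages eventually differ by at most three such errors. *)
Lemma avg_equiv_approx G H :
  (forall e, 0 < e -> exists G1 H1,
    [/\ avg_equiv G G1, avg_equiv H H1 & forall x, `|G1 x - H1 x| <= e]) ->
  avg_equiv G H.
Proof.
move=> h.
have /ae_foralln : forall m : nat, {ae P, forall w, \forall n \near \oo,
    `|(\sum_(i < n) (G (walk X i w) - H (walk X i w))) / n%:R| <= 3 * m.+1%:R^-1}.
  move=> m; pose e : R := m.+1%:R^-1.
  have e0 : 0 < e by rewrite invr_gt0 ltr0n.
  have [G1 [H1 [GG1 HH1 GH]]] := h e e0.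
  apply: filterS2 GG1 HH1 => w.
  move=> /cvgr0Pnorm_le/(_ e e0) h1 /cvgr0Pnorm_le/(_ e e0) h2.
  near=> n; have n0 : 0 < (n%:R : R) by rewrite ltr0n; near: n; exists 1%N.
  have a1 : `|(\sum_(i < n) (G (walk X i w) - G1 (walk X i w))) / n%:R| <= e.
    by near: n.
  have a2 : `|(\sum_(i < n) (H (walk X i w) - H1 (walk X i w))) / n%:R| <= e.
    by near: n.
  have a3 : `|(\sum_(i < n) (G1 (walk X i w) - H1 (walk X i w))) / n%:R| <= e.
    rewrite normrM normfV (ger0_norm (ltW n0)) ler_pdivrMr//.
    apply: le_trans (ler_norm_sum _ _ _) _.
    apply: (@le_trans _ _ (\sum_(i < n) e)); first exact: ler_sum.
    by rewrite sumr_const card_ord mulr_natr.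
  have -> : (\sum_(i < n) (G (walk X i w) - H (walk X i w))) / n%:R =
     (\sum_(i < n) (G (walk X i w) - G1 (walk X i w))) / n%:R
     + (\sum_(i < n) (G1 (walk X i w) - H1 (walk X i w))) / n%:R
     - (\sum_(i < n) (H (walk X i w) - H1 (walk X i w))) / n%:R :> R.
    by rewrite -mulrDl -mulrBl -big_split -sumrB /=; congr (_ / _);
      apply: eq_bigr => i _; ring.
  apply: le_trans (ler_normB _ _) _; apply: le_trans (lerD (ler_normD _ _) a2) _.
  by rewrite -/e; lra.
apply: filterS => w hw; apply/cvgr0Pnorm_le => e e0.
have [m me] : exists m : nat, 3 * m.+1%:R^-1 <= e.
  exists (Num.bound (3 / e)).
  rewrite ler_pdivrMr ?ltr0n// mulrC -ler_pdivrMr//.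
  have q0 : 0 <= 3 / e by rewrite divr_ge0// ltW.
  by apply: le_trans (ltW (archi_boundP q0)) _; rewrite ler_nat.
by apply: filterS (hw m) => n /le_trans; exact.
Unshelve. all: by end_near. Qed.

(** The strong law for [G (x + k)] compares [G (S_(i+1))] with [shift_op X G (S_i)]; moving the
    index back by one costs the bounded boundary term [G (S_0) - G (S_n)]. *)
Lemma avg_equiv_shift_op B G : (forall x, `|G x| <= B) ->
  avg_equiv G (shift_op X G).
Proof.
move=> GB.
have gG x : affine_growth B (fun k => G (x + k)) by exact: affine_growth_bounded.
have := slln Xiid X_int C0 beta1 X_tail gG.
apply: filterS => w h.
have hB n : `|G (walk X 0 w) - G (walk X n w)| <= B + B.
  by rewrite (le_trans (ler_normB _ _))// lerD.
rewrite -[X in _ --> X]addr0.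
rewrite (_ : (fun n => _) = (fun n =>
  (\sum_(i < n) (G (walk X i w + X i w) - shift_op X G (walk X i w))) / n%:R
  + (G (walk X 0 w) - G (walk X n w)) / n%:R)); last first.
  apply/funext => n; rewrite -mulrDl; congr (_ / _).
  rewrite -[G (walk X 0 w) - _]opprB.
  rewrite -(telescope_sumr (fun i => G (walk X i w)) (leq0n n)).
  rewrite big_mkord -sumrB; apply: eq_bigr => i _.
  by rewrite walkS; ring.
exact: cvgD h (cvg_bounded_div hB).
Qed.

Lemma avg_equiv_iter_shift_op B G m : (forall x, `|G x| <= B) ->
  avg_equiv G (iter m (shift_op X) G).
Proof.
move=> GB; elim: m => [|m IHm]; first exact: avg_equiv_refl.
apply: (avg_equiv_trans IHm); apply: (@avg_equiv_shift_op B).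
exact: (iter_shift_op_bounded X_int).
Qed.

Lemma iter_shift_op_translate m a G x :
  iter m (shift_op X) (fun y => G (y + a)) x = iter m (shift_op X) G (x + a).
Proof.
elim: m x => //= m IHm x; rewrite /shift_op; congr (expect X _).
by apply/funext => k; rewrite IHm addrAC.
Qed.

(** Both functions may be replaced by iterates of the transition operator, [r * r - 1] of them for
    the translate and [r * r] for [G]; these are uniformly within [B / mass X a / r] of each
    other. *)
Lemma avg_equiv_atom B G a : (forall x, `|G x| <= B) -> 0 < mass X a ->
  avg_equiv (fun x => G (x + a)) G.
Proof.
move=> GB a0; apply: avg_equiv_approx => e e0.
have B0 : 0 <= B by exact: le_trans (GB 0).
pose q := B / mass X a / e.
have q0 : 0 <= q by rewrite !divr_ge0// ltW.
pose r := (Num.bound q).+1.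
have re : B / mass X a / r%:R <= e.
  rewrite ler_pdivrMr ?ltr0n// [leRHS]mulrC -ler_pdivrMr//.
  by apply: le_trans (ltW (archi_boundP q0)) _; rewrite ler_nat.
exists (iter (r * r).-1 (shift_op X) (fun x => G (x + a))).
exists (iter (r * r) (shift_op X) G); split.
- by apply: (@avg_equiv_iter_shift_op B) => x.
- exact: (@avg_equiv_iter_shift_op B).
- move=> x; rewrite iter_shift_op_translate.
  have r0 : (0 < r)%N by [].
  by apply: le_trans re; exact: (shift_op_translate X_int GB a0 r0 x).
Qed.

Lemma avg_equiv_translate h : nondegenerate_walk X ->
  forall B G, (forall x, `|G x| <= B) -> avg_equiv (fun x => G (x + h)) G.
Proof.
move=> ndg.
(* The good translations form a subgroup containing every atom. They are required to work for all
   bounded functions at once, because closure under [x - y] applies the property of [x] to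
   [G (z - y)]. *)
pose H : set int := [set h | forall B G,
  (forall x, `|G x| <= B) -> avg_equiv (fun x => G (x + h)) G].
suff : H h by [].
have : [set: int] h by [].
rewrite -ndg; apply; split.
  split; first by rewrite inE => B G GB; under eq_fun do rewrite addr0;
    exact: avg_equiv_refl.
  move=> x y; rewrite !inE => Hx Hy B G GB.
  have GyB z : `|G (z - y)| <= B by exact: GB.
  apply: (@avg_equiv_trans (fun z => G (z - y))).
    have := Hx _ _ GyB.
    by under [X in avg_equiv X _]eq_fun do rewrite -addrA.
  have := Hy _ _ GyB; under [X in avg_equiv X _]eq_fun do rewrite addrK.
  exact: avg_equiv_sym.
move=> a; rewrite /ess_range /= => a0 B G GB; apply: (avg_equiv_atom GB).
rewrite /mass fine_gt0// a0 /=.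
by rewrite (le_lt_trans (probability_le1 _ _)) ?ltry//; exact: measurable_step.
Qed.

End equivalence_in_average.

(** * Discrete primitives *)

Lemma eq_near_cvg (R : realType) (f g : nat -> R) (l : R) :
  (\forall n \near \oo, g n = f n) -> f n @[n --> \oo] --> l ->
  g n @[n --> \oo] --> l.
Proof.
move=> fg; apply: cvg_trans; apply: near_eq_cvg.
by apply: filterS fg => n ->.
Qed.

(** The discrete antiderivative of [F] that vanishes at [0]. As [Negz n] is [-(n + 1)], the second
    sum covers the integers from [-(n + 1)] to [-1]. *)
Definition primitive (R : realType) (F : int -> R) (x : int) : R :=
  match x with
  | Posz n => \sum_(0 <= j < n) F j%:Z
  | Negz n => - \sum_(0 <= j < n.+1) F (- j.+1%:Z)
  end.

Lemma primitiveS (R : realType) (F : int -> R) x :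
  primitive F (x + 1) = primitive F x + F x.
Proof.
case: x => [n|[|n]].
- by rewrite -PoszD addn1 /= big_nat_recr.
- by rewrite /= big_nat1 big_nil addNr.
- have -> : Negz n.+1 + 1 = Negz n by rewrite !NegzE; lia.
  rewrite /= [in RHS]big_nat_recr//= NegzE.
  by rewrite opprD subrK.
Qed.

Lemma primitive_lipschitz (R : realType) (F : int -> R) B :
  (forall x, `|F x| <= B) ->
  forall x k, `|primitive F (x + k) - primitive F x| <= B * `|k%:~R|.
Proof.
move=> FB.
have pos (n : nat) x : `|primitive F (x + n%:Z) - primitive F x| <= B * n%:R.
  elim: n => [|n IHn]; first by rewrite addr0 subrr normr0 mulr0.
  rewrite -addn1 PoszD addrA primitiveS natrD mulrDr mulr1.
  by rewrite addrAC (le_trans (ler_normD _ _))// lerD.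
move=> x [n|n]; first by rewrite -pmulrn normr_nat.
(* A negative increment from [x] is a positive one from [x + k], read backwards. *)
have -> : `|(Negz n)%:~R| = n.+1%:R :> R.
  by rewrite NegzE mulrNz normrN -pmulrn normr_nat.
rewrite distrC; have := pos n.+1 (x + Negz n); congr (`|primitive F _ - _| <= _).
by rewrite NegzE subrK.
Qed.

(** The increment of the primitive over [k] is a signed sum of [|k|] translates of [F]. Moving [k]
    by one away from [0] brings in a single translate, which averages like [F] by hypothesis. *)
Lemma primitive_average (R : realType) (F : int -> R) (s : nat -> int) :
  (forall h, (\sum_(i < n) (F (s i + h) - F (s i))) / n%:R @[n --> \oo] --> 0) ->
  forall k, (\sum_(i < n) (primitive F (s i + k) - primitive F (s i)
    - k%:~R * F (s i))) / n%:R @[n --> \oo] --> 0.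
Proof.
move=> sF; elim/int_rect => [|k IHk|k IHk].
- rewrite (_ : (fun n => _) = cst 0); first exact: cvg_cst.
  apply/funext => n; rewrite big1 ?mul0r// => i _.
  by rewrite addr0 subrr mul0r subr0.
- rewrite -[X in _ --> X]addr0; rewrite (_ : (fun n => _) = (fun n =>
    (\sum_(i < n) (primitive F (s i + k%:Z) - primitive F (s i)
      - k%:~R * F (s i))) / n%:R
    + (\sum_(i < n) (F (s i + k%:Z) - F (s i))) / n%:R)); first exact: cvgD.
  apply/funext => n; rewrite -mulrDl -big_split; congr (_ / _).
  apply: eq_bigr => i _ /=; rewrite -addn1 PoszD addrA primitiveS intrD; ring.
- rewrite -[X in _ --> X]subr0; rewrite (_ : (fun n => _) = (fun n =>
    (\sum_(i < n) (primitive F (s i - k%:Z) - primitive F (s i)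
      - (- k%:Z)%:~R * F (s i))) / n%:R
    - (\sum_(i < n) (F (s i - k.+1%:Z) - F (s i))) / n%:R)); first exact: cvgB.
  apply/funext => n; rewrite -mulrBl -sumrB; congr (_ / _).
  apply: eq_bigr => i _ /=.
  have -> : s i - k%:Z = s i - k.+1%:Z + 1 by lia.
  rewrite primitiveS -[in (- k.+1%:Z)%:~R]addn1 PoszD opprD intrD.
  by rewrite [(- 1)%:~R]mulrNz; ring.
Qed.

(** * Convergence of the occupation averages *)

Section occupation.
Context d (T : measurableType d) (R : realType) (P : probability T R).
Context (X : nat -> {RV P >-> int}).
Hypothesis X_int : P.-integrable setT (fun w => ((X 0%N w)%:~R : R)%:E).

Lemma expect_sum c (g : nat -> int -> R) n :
  (forall i, affine_growth c (g i)) ->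
  affine_growth (n%:R * c) (fun k => \sum_(i < n) g i k) /\
  expect X (fun k => \sum_(i < n) g i k) = \sum_(i < n) expect X (g i).
Proof.
move=> gc; elim: n => [|n [IHg IHe]].
  under eq_fun do rewrite big_ord0; rewrite big_ord0 expect_cst; split=> //.
  by move=> k; rewrite normr0 !mul0r.
under eq_fun do rewrite big_ord_recr/=.
split; first by rewrite -natr1 mulrDl mul1r; exact: affine_growthD.
by rewrite (expectD X_int IHg (gc n)) IHe big_ord_recr.
Qed.

End occupation.

Lemma average_right_primitive (R : realType) (F : int -> R) n :
  average_right F n = primitive F n.+1%:Z / n.+1%:R.
Proof. by []. Qed.

(** For large [n] the quotient is the average of [F] over [[0, s n - 1]] times [s n / n]; positivity
    of [v] sends [s n] to infinity. *)
Lemma cvg_primitive_ratio (R : realType) (F : int -> R) (s : nat -> int)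
    (v : R) :
  cvgn (average_right F) -> 0 < v -> (s n)%:~R / n%:R @[n --> \oo] --> v ->
  primitive F (s n) / n%:R @[n --> \oo] --> mean_right F * v.
Proof.
move=> cF v0 sv.
have v20 : 0 < v / 2 by rewrite divr_gt0.
have big : \forall n \near \oo, v / 2 * n%:R <= (s n)%:~R /\ (0 < n)%N.
  move/cvgrPdist_le : (sv) => /(_ _ v20) h.
  near=> n; have n0 : (0 < n)%N by near: n; exists 1%N.
  split=> //; have : `|v - (s n)%:~R / n%:R| <= v / 2 by near: n.
  rewrite ler_distlC => /andP[+ _].
  by rewrite -ler_pdivlMr ?ltr0n//; apply: le_trans; lra.
(* [average_right F m] averages [m + 1] values, hence the predecessor. *)
have sinf : (`|s n|%N).-1 @[n --> \oo] --> \oo.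
  apply/cvgnyPge => A.
  near=> n; have [h n0] : v / 2 * n%:R <= (s n)%:~R /\ (0 < n)%N by near: n.
  rewrite -ltnS; apply: (@leq_trans `|s n|%N); last exact: leqSpred.
  rewrite -(ltr_nat R) -absz_intr (lt_le_trans _ (ler_norm _))//.
  apply: lt_le_trans h; rewrite mulrC -ltr_pdivrMr//.
  near: n; exact: nbhs_infty_gtr.
apply: (eq_near_cvg _ (cvgM (cvg_comp _ _ sinf cF) sv)).
near=> n; have [h n0] : v / 2 * n%:R <= (s n)%:~R /\ (0 < n)%N by near: n.
have sn0 : (0 < (s n)%:~R :> R).
  by apply: lt_le_trans h; rewrite mulr_gt0// ltr0n.
rewrite /= average_right_primitive.
have [p sp] : exists p : nat, s n = p.+1%:Z.
  by move: sn0; rewrite ltr0z; case: (s n) => [[|p]|p]//; exists p.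
rewrite sp /= -pmulrn mulrA mulfVK// pnatr_eq0.
Unshelve. all: by end_near. Qed.

Theorem theorem1p8 (R : realType) (d : measure_display) (T : measurableType d)
    (P : probability T R) (X : nat -> {RV P >-> int}) (v C beta : R)
    (F : int -> R) :
  iid X -> nondegenerate_walk X -> aperiodic_walk X ->
  'E_P[fun w => (X 0%N w)%:~R]%E = v%:E -> 0 < v ->
  0 < C -> 1 < beta ->
  (forall t : R, 1 <= t ->
     (P [set w | (t < `|(X 0%N w)%:~R|)%R] <= (C / t `^ beta)%:E)%E) ->
  G_plus F ->
  {ae P, forall w,
     occupation_sum F X N w / N%:R @[N --> \oo] --> mean_right F}.
Proof.
move=> Xiid ndg _ EX v0 C0 beta1 X_tail [[M [_ FM]] cF].
have [B FB] : exists B : R, forall x, `|F x| <= B.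
  by exists (M + 1) => x; apply: FM => //; rewrite ltrDl.
have B0 : 0 <= B by exact: le_trans (FB 0).
have mX : measurable_fun setT (fun w => ((X 0%N w)%:~R : R)).
  exact: (@measurable_fun_step _ _ _ _ X _ _ _ (fun k => k%:~R : R)).
(* An infinite positive or negative part would make the expectation infinite, so the finite value
   [v] yields integrability. *)
have X_int : P.-integrable setT (fun w => ((X 0%N w)%:~R : R)%:E).
  move: EX; rewrite unlock => EX.
  apply/integrableP; split; first exact/measurable_EFinP.
  by rewrite integral_fin_num_abs// EX.
have expect_id : expect X (fun k => k%:~R) = v.
  by move: EX; rewrite unlock /expect /Rintegral => ->.
pose Phi := primitive F.
have phic x : affine_growth B (fun k => Phi (x + k) - Phi x).
  move=> k; apply: le_trans (primitive_lipschitz FB x k) _.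
  by rewrite ler_wpM2l// lerDr.
have idc : forall x : int, affine_growth 1 (fun k : int => k%:~R : R).
  by move=> _ k; rewrite mul1r lerDr.
have Fc x : affine_growth B (fun k : int => k%:~R * F x).
  by move=> k; rewrite normrM mulrC ler_pM// lerDr.
(* All integer translations must share one null set; they are enumerated through their codes. *)
have translates : {ae P, forall w, forall h : int,
    (\sum_(i < n) (F (walk X i w + h) - F (walk X i w))) / n%:R
      @[n --> \oo] --> 0}.
  have tr h : avg_equiv X (fun x => F (x + h)) F.
    exact: (avg_equiv_translate Xiid X_int C0 beta1 X_tail h ndg FB).
  have /ae_foralln : forall m : nat, {ae P, forall w, forall h : int,
      choice.unpickle m = Some h ->
      (\sum_(i < n) (F (walk X i w + h) - F (walk X i w))) / n%:R
        @[n --> \oo] --> 0}.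
    move=> m; case: (choice.unpickle m) => [h|]; last exact: aeW.
    by apply: filterS (tr h) => w hw _ [<-].
  by apply: filterS => w hw h; apply: (hw (choice.pickle h)); exact: choice.pickleK.
(* The path [w] is fixed from here on. The strong law is used for the increments
   [Phi (x + k) - Phi x] and for [k] itself. *)
apply: filterS3 translates (slln Xiid X_int C0 beta1 X_tail phic)
  (slln Xiid X_int C0 beta1 X_tail idc) => w tr lawPhi lawX.
pose s i := walk X i w.
have s_ratio : (s n)%:~R / n%:R @[n --> \oo] --> v.
  rewrite -[X in _ --> X]add0r.
  apply: (eq_near_cvg _ (cvgD lawX (cvg_cst v))); exists 1%N => // n /= n0.
  rewrite expect_id sumrB sumr_const card_ord mulrBl -[v *+ _]mulr_natr.
  rewrite mulfK ?pnatr_eq0 -?lt0n// subrK; congr (_ / _).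
  by rewrite /s /walk rmorph_sum.
have PhiF := cvg_primitive_ratio cF v0 s_ratio.
(* The average over positions is taken first, with [k] fixed; a bound [(B + B) (1 + |k|)] uniform in
   [n] then lets dominated convergence pass to the mean over [k]. *)
pose f n (k : int) : R :=
  (\sum_(i < n) (Phi (s i + k) - Phi (s i) - k%:~R * F (s i))) / n%:R.
have gc i :
    affine_growth (B + B) (fun k => Phi (s i + k) - Phi (s i) - k%:~R * F (s i)).
  exact: affine_growthB.
have fc n : affine_growth (B + B) (f n).
  move=> k; rewrite /f normrM normfV (ger0_norm (ler0n _ _)).
  have [->|n0] := eqVneq n 0%N.
    by rewrite invr0 mulr0 mulr_ge0// addr_ge0.
  rewrite ler_pdivrMr ?ltr0n ?lt0n//; apply: le_trans (ler_norm_sum _ _ _) _.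
  apply: (@le_trans _ _ (\sum_(i < n) ((B + B) * (1 + `|k%:~R|)))).
    by apply: ler_sum => i _; exact: gc.
  by rewrite sumr_const card_ord mulr_natr.
have fE n : expect X (f n) = (\sum_(i < n)
    (expect X (fun k => Phi (s i + k) - Phi (s i)) - v * F (s i))) / n%:R.
  have [g gE] := expect_sum X_int n gc.
  rewrite /f; under eq_fun do rewrite mulrC.
  rewrite (expectZ X_int _ g) gE mulrC; congr (_ / _); apply: eq_bigr => i _.
  rewrite (expectB X_int (phic _) (Fc _)) -expect_id mulrC.
  rewrite -(expectZ X_int _ (idc 0)); congr (_ - expect X _).
  by apply/funext => k; rewrite mulrC.
have f0 : (\sum_(i < n)
    (expect X (fun k => Phi (s i + k) - Phi (s i)) - v * F (s i))) / n%:R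
    @[n --> \oo] --> 0.
  rewrite (_ : (fun n => _) = (fun n => expect X (f n))).
    by apply: (expect_cvg0 X_int fc) => k; exact: (primitive_average (s := s) tr).
  by apply/funext => n; rewrite fE.
(* [Phi (S_n)] telescopes; removing its martingale part and then the sum in [f0] leaves exactly [v]
   times the sum of [F (S_i)]. *)
have vF : v * ((\sum_(i < n) F (s i)) / n%:R) @[n --> \oo] --> mean_right F * v.
  rewrite -[X in _ --> X]subr0 -[X in _ --> X]subr0.
  apply: (eq_near_cvg _ (cvgB (cvgB PhiF lawPhi) f0)); apply: nearW => n.
  rewrite mulrA (_ : v * _ = primitive F (s n)
    - \sum_(i < n) (Phi (s i + X i w) - Phi (s i)
        - expect X (fun k => Phi (s i + k) - Phi (s i)))
    - \sum_(i < n) (expect X (fun k => Phi (s i + k) - Phi (s i)) - v * F (s i))).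
    by rewrite !mulrBl.
  have -> : primitive F (s n) = \sum_(i < n) (Phi (s i + X i w) - Phi (s i)).
    rewrite -/Phi; have := telescope_sumr (fun i => Phi (s i)) (leq0n n).
    rewrite big_mkord [s 0%N]big_ord0 [Phi 0]big_nil subr0 => <-.
    by apply: eq_bigr => i _; rewrite /s walkS.
  by rewrite -!sumrB mulr_sumr; apply: eq_bigr => i _; ring.
have hB n : `|F (s n) - F (s 0%N)| <= B + B.
  by rewrite (le_trans (ler_normB _ _))// lerD.
have mF : (\sum_(i < n) F (s i)) / n%:R @[n --> \oo] --> mean_right F.
  rewrite (_ : mean_right F = v^-1 * (mean_right F * v)); last first.
    by field; rewrite gt_eqF.
  apply: (eq_near_cvg _ (cvgMr (a := v^-1) vF)); apply: nearW => n.
  by rewrite mulKf ?gt_eqF.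
(* [occupation_sum] runs over the times [1] to [n], the averages in [mF] over [0] to [n - 1]; the
   bounded boundary term accounts for the difference. *)
rewrite -[X in _ --> X]addr0.
apply: (eq_near_cvg _ (cvgD mF (cvg_bounded_div hB))); apply: nearW => n /=.
rewrite -mulrDl; congr (_ / _); rewrite /occupation_sum.
rewrite -(big_mkord xpredT (fun i => F (s i))).
rewrite addrA -big_nat_recr//= -[LHS](addrK (F (s 0%N))); congr (_ - _).
by rewrite [RHS]big_ltn// addrC.
Qed.
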